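(* Let $X$ and $Y$ be finite nonempty sets and let $F: X \to 2^Y$ be a set-valued mapping which admits a Hall partition $(W_1,\ldots,W_m)$. Then $F^* = F^p$, i.e. for every $i$ and every $x \in W_i$, $F^*(x) = F(x) \setminus F(W_1 \cup \cdots \cup W_{i-1})$.
   Context: A set-valued mapping $F: X \to 2^Y$ assigns to each $x$ a (possibly empty) subset $F(x) \subset Y$; $F(W) = \bigcup_{x\in W}F(x)$; $\sharp$ is cardinality. A selection of $F$ is a map $s: X \to Y$ with $s(x) \in F(x)$ for all $x$; it is alldifferent if it is injective. The alldifferent kernel $F^*: X \to 2^Y$ is $F^*(x) = \{ y \in F(x) : \text{there is an alldifferent selection } s \text{ of } F \text{ with } s(x) = y\}$. For $W \subset X$, $F_W: X\setminus W \to 2^Y$ is $F_W(x) = F(x) \setminus F(W)$. For any set-valued $G$ on a finite set, a subset $W$ of its domain is critical for $G$ if $W\ne\emptyset$ and $\sharp G(W)=\sharp W$, and non-reducible for $G$ if $W \ne\emptyset$ and no proper subset of $W$ is critical for $G$. A tuple $(W_1,\ldots,W_m)$, $m\ge1$, is a Hall partition of $F$ if the $W_i$ are nonempty, pairwise disjoint with union $X$, and with $G_i = F_{W_1\cup\cdots\cup W_{i-1}}$ ($G_1=F$): (i) $G_i(x)\neq\emptyset$ for $x \in W_i$, all $i$; (ii) $W_i$ is non-reducible for $G_i$, all $i$; (iii) $W_i$ is critical for $G_i$ for $i \le m-1$. Given a Hall partition, $F^p: X \to 2^Y$ is defined by $F^p(x) = G_i(x)$ for $x \in W_i$. *)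

(* Defs.v *)
From mathcomp Require Import all_boot.

Set Implicit Arguments.
Unset Strict Implicit.
Unset Printing Implicit Defensive.

Section SetValued.
Variables X Y : finType.
Implicit Types (F G : X -> {set Y}) (D V W : {set X}) (s : {ffun X -> Y}).

Definition image_set F W : {set Y} := \bigcup_(x in W) F x.

Definition selection F s : bool := [forall x, s x \in F x].

Definition alldiff_selection F s : bool := selection F s && injectiveb s.

Definition alldiff_kernel F (x : X) : {set Y} :=
  [set y in F x | [exists s : {ffun X -> Y}, alldiff_selection F s && (s x == y)]].

(* The residual mapping F_W has domain X \ W.  It is encoded as a total
   function, to be used only together with the domain ~: W. *)
Definition residual F W (x : X) : {set Y} := F x :\: image_set F W.

(* In the next two notions D is the domain of the set-valued mapping G,
   whose values outside D are irrelevant. *)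
Definition critical D G W : bool :=
  [&& W \subset D, W != set0 & #|image_set G W| == #|W|].

Definition nonreducible D G W : bool :=
  [&& W \subset D, W != set0 &
      [forall V : {set X}, (V \proper W) ==> ~~ critical D G V]].

Section HallPartition.
Variables (F : X -> {set Y}) (m : nat) (W : m.-tuple {set X}).

(* Blocks are numbered from 0: [prior i] is the union of the blocks strictly
   before block i, and it is empty for the first block. *)
Definition prior (i : 'I_m) : {set X} := \bigcup_(j < m | j < i) tnth W j.

Definition stage (i : 'I_m) : X -> {set Y} := residual F (prior i).

Definition stage_dom (i : 'I_m) : {set X} := ~: prior i.

Record hall_partition : Prop := HallPartition {
  hall_pos : 0 < m;
  hall_neq0 : forall i, tnth W i != set0;
  hall_disjoint : forall i j, i != j -> [disjoint tnth W i & tnth W j];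
  hall_cover : \bigcup_(i < m) tnth W i = [set: X];
  hall_value_neq0 : forall i x, x \in tnth W i -> stage i x != set0;
  hall_nonreducible : forall i, nonreducible (stage_dom i) (stage i) (tnth W i);
  hall_critical : forall i : 'I_m,
    i.+1 < m -> critical (stage_dom i) (stage i) (tnth W i)
}.

(* When W is a Hall partition, the picked block is the unique one containing x
   and the [None] case does not occur. *)
Definition partition_map (x : X) : {set Y} :=
  if [pick i | x \in tnth W i] is Some i then stage i x else set0.

End HallPartition.
End SetValued.

(* Main.v *)
Require Import Defs.
From mathcomp Require Import all_boot.

Set Implicit Arguments.
Unset Strict Implicit.
Unset Printing Implicit Defensive.

(** On a non-reducible block every proper nonempty part has a surplus of values,
    so Hall's theorem still applies after one value of one point is prescribed;
    the values used by different blocks are disjoint, so selections of the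
    blocks glue together.  Conversely, every block but the last is critical, so
    an alldifferent selection uses up all the values of the earlier blocks,
    which are then unavailable to the later ones. *)

Section Matching.
Variables X Y : finType.
Implicit Types (G : X -> {set Y}) (D U V : {set X}) (A : {set Y}).
Implicit Types f g : X -> Y.

(** The map [f] is total and its values outside [D] are irrelevant, so one function can be read on
    any subset without subtypes. *)
Definition matching D G f : Prop :=
  {in D, forall x, f x \in G x} /\ {in D &, injective f}.

Definition hall_condition D G : Prop :=
  forall V, V \subset D -> #|V| <= #|image_set G V|.

Definition surplus D G : Prop :=
  forall V, V \proper D -> V != set0 -> #|V| < #|image_set G V|.

Lemma image_setP G V y :
  reflect (exists2 x, x \in V & y \in G x) (y \in image_set G V).
Proof. exact: bigcupP. Qed.

Lemma image_setS G U V : U \subset V -> image_set G U \subset image_set G V.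
Proof.
move=> sUV; apply/subsetP => y /image_setP[x Ux Gxy].
by apply/image_setP; exists x => //; apply: (subsetP sUV).
Qed.

Lemma image_setU G U V :
  image_set G (U :|: V) = image_set G U :|: image_set G V.
Proof. exact: bigcup_setU. Qed.

Lemma image_setD G A V :
  image_set (fun x => G x :\: A) V = image_set G V :\: A.
Proof.
apply/setP => y; rewrite in_setD; apply/image_setP/andP => [[x Vx]|[nAy]].
  by rewrite in_setD => /andP[-> Gxy]; split=> //; apply/image_setP; exists x.
by case/image_setP=> x Vx Gxy; exists x => //; rewrite in_setD nAy.
Qed.

(** Deleting [y] costs an image at most one value, and the surplus pays for it: a part of [D :\ x]
    is proper in [D]. *)
Lemma surplus_hall_condition D G x y :
  x \in D -> surplus D G -> hall_condition (D :\ x) (fun z => G z :\ y).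
Proof.
move=> Dx surp V sV; have [-> | nV0] := eqVneq V set0; first by rewrite cards0.
have /surp/(_ nV0) : V \proper D by apply: sub_proper_trans sV (properD1 Dx).
rewrite image_setD (cardsD1 y (image_set G V)) => lt.
by rewrite -ltnS; apply: leq_trans lt _; rewrite -add1n leq_add2r leq_b1.
Qed.

Lemma matching_add1 D G x y f :
  y \in G x -> matching (D :\ x) (fun z => G z :\ y) f ->
  exists2 g, matching D G g & g x = y.
Proof.
move=> Gxy [fG finj]; exists (fun z => if z == x then y else f z); last first.
  by rewrite eqxx.
have fP z : z \in D -> z != x -> (f z != y) && (f z \in G z).
  by move=> Dz nzx; have := fG z; rewrite !inE nzx Dz => /(_ isT).
split=> [z Dz | z t Dz Dt]; first by case: eqVneq => [-> //|/(fP z Dz)/andP[]].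
case: eqVneq => [->|nzx]; case: eqVneq => [->|ntx] // e.
- by have := fP t Dt ntx; rewrite -e eqxx.
- by have := fP z Dz nzx; rewrite e eqxx.
by apply: finj => //; rewrite !inE ?nzx ?ntx.
Qed.

(** No collision between [f] and [g] is possible, since [residual] withholds from [D :\: U] every
    value available on [U]. *)
Lemma matching_glue D U G f g :
  matching U G f -> matching (D :\: U) (residual G U) g ->
  exists h, matching D G h.
Proof.
move=> [fG finj] [gG ginj]; exists (fun z => if z \in U then f z else g z).
have gP z : z \in D -> z \notin U -> (g z \notin image_set G U) && (g z \in G z).
  by move=> Dz nUz; have := gG z; rewrite !inE nUz Dz => /(_ isT).
have fP z : z \in U -> f z \in image_set G U.
  by move=> Uz; apply/image_setP; exists z => //; apply: fG.
split=> [z Dz | z t Dz Dt].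
  by case: ifPn => [/fG //|/(gP z Dz)/andP[]].
case: ifPn => Uz; case: ifPn => Ut e.
- exact: finj.
- by have := gP t Dt Ut; rewrite -e fP.
- by have := gP z Dz Uz; rewrite e fP.
by apply: ginj => //; rewrite !inE ?Uz ?Ut.
Qed.

(** Induction on [#|D|]. If some proper nonempty [U] has exactly [#|U|] values, then [U] and
    [D :\: U] are matched separately. Otherwise there is a surplus, and any value may be fixed at
    any one point. *)
Lemma hall_marriage (y0 : Y) D G :
  hall_condition D G -> exists f, matching D G f.
Proof.
have [n] := ubnP #|D|; elim: n D G => // n IHn D G ltDn hall.
have [D0 | [x Dx]] := set_0Vmem D.
  (* Nothing to match; [y0] only provides some function, as [Y] could be empty. *)
  by exists (fun=> y0); split=> [z | z t]; rewrite D0 inE.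
case: (pickP [pred U : {set X} |
         [&& U \proper D, U != set0 & #|image_set G U| == #|U|]]) => [U | noU].
  case/and3P=> pUD nU0 /eqP cardU.
  have sUD := proper_sub pUD.
  have [||f mf] := IHn U G.
  - exact: leq_trans (proper_card pUD) ltDn.
  - by move=> V sVU; apply/hall/subset_trans/sUD.
  have [||g] := IHn (D :\: U) (residual G U); last exact: matching_glue mf.
  - apply: leq_trans (proper_card _) ltDn; apply/properP.
    split; first exact: subsetDl.
    have [u Uu] := set0Pn _ nU0.
    by exists u; [apply: (subsetP sUD) | rewrite inE Uu].
  move=> V; rewrite subsetD => /andP[sVD dVU].
  (* At most [#|U|] values of [V :|: U] come from [U], so at least [#|V|] remain outside the image
     of [U]. *)
  have := hall (V :|: U); rewrite subUset sVD sUD => /(_ isT).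
  rewrite image_setU !cardsU (disjoint_setI0 dVU) cards0 subn0 cardU.
  by rewrite -addnBAC ?subset_leq_card ?subsetIl // leq_add2r image_setD cardsD.
have surp : surplus D G.
  move=> V pVD nV0; have := noU V; rewrite /= pVD nV0 /= => /negbT neq.
  by rewrite ltn_neqAle eq_sym neq hall // proper_sub.
have [y Gxy] : exists y, y \in G x.
  have /hall : [set x] \subset D by rewrite sub1set.
  by rewrite cards1 /image_set big_set1 card_gt0 => /set0Pn.
have [||f mf] := IHn (D :\ x) (fun z => G z :\ y).
- exact: leq_trans (proper_card (properD1 Dx)) ltDn.
- exact: surplus_hall_condition.
by have [g] := matching_add1 Gxy mf; exists g.
Qed.

(** Induction on [#|U|]: the surplus of [U :\ x] already gives [U] at least [#|U|] values, and
    equality would make [U] critical. Nonempty values settle singletons. *)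
Lemma nonreducible_surplus D G V :
  nonreducible D G V -> {in V, forall x, G x != set0} -> surplus V G.
Proof.
case/and3P=> sVD _ /forallP nocrit nG0 U.
have [n] := ubnP #|U|; elim: n U => // n IHn U ltUn pUV nU0.
have [x Ux] := set0Pn _ nU0.
have sUV := proper_sub pUV.
have neq : #|U| != #|image_set G U|.
  apply: contraNneq (implyP (nocrit U) pUV) => eqU.
  by rewrite /critical nU0 (subset_trans sUV sVD) eqU eqxx.
rewrite ltn_neqAle neq /=; have [U1 | nU1] := eqVneq (U :\ x) set0.
  rewrite (cardsD1 x) Ux U1 cards0 card_gt0.
  have [y Gxy] := set0Pn _ (nG0 x (subsetP sUV x Ux)).
  by apply/set0Pn; exists y; apply/image_setP; exists x.
rewrite (cardsD1 x) Ux add1n; apply: leq_trans (subset_leq_card _).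
  apply: IHn nU1; last exact: sub_proper_trans (subD1set _ _) pUV.
  by move: ltUn; rewrite (cardsD1 x) Ux.
exact/image_setS/subD1set.
Qed.

(** Surplus is asked of proper parts only, so this covers a critical [D] too. *)
Lemma surplus_matching D G x y :
  surplus D G -> x \in D -> y \in G x -> exists2 f, matching D G f & f x = y.
Proof.
move=> surp Dx Gxy.
have [f mf] := hall_marriage y (surplus_hall_condition y Dx surp).
exact: matching_add1 Gxy mf.
Qed.

End Matching.

Section HallPartition.
Variables (X Y : finType) (F : X -> {set Y}) (m : nat) (W : m.-tuple {set X}).
Hypothesis hW : hall_partition F W.

Lemma block_exists x : exists i, x \in tnth W i.
Proof.
have : x \in [set: X] by rewrite inE.
by rewrite -(hall_cover hW) => /bigcupP[i _ Wx]; exists i.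
Qed.

Lemma block_inj x i j : x \in tnth W i -> x \in tnth W j -> i = j.
Proof.
move=> Wi Wj; apply/eqP/negPn/negP => /(hall_disjoint hW)/disjointFr/(_ Wi).
by rewrite Wj.
Qed.

Lemma block_prior x (i j : 'I_m) : x \in tnth W i -> i < j -> x \in prior W j.
Proof. by move=> Wx ltij; apply/bigcupP; exists i. Qed.

Lemma stage_disjoint x z (i j : 'I_m) y :
  x \in tnth W i -> i < j -> y \in stage F W i x -> y \notin stage F W j z.
Proof.
move=> Wx ltij; rewrite !inE => /andP[_ Fxy]; rewrite negb_and negbK.
by apply/orP; left; apply/image_setP; exists x => //; apply: block_prior ltij.
Qed.

Lemma block_surplus i : surplus (tnth W i) (stage F W i).
Proof.
apply: nonreducible_surplus (hall_nonreducible hW i) _ => x.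
exact: hall_value_neq0.
Qed.

(** Strong induction on the block index. For [j < i], the values of the blocks before [j] are
    already taken there by [s], so injectivity sends block [j] into its stage image; criticality
    makes the two sizes equal, hence [s] exhausts that image. *)
Lemma alldiff_image_prior (s : {ffun X -> Y}) (i : 'I_m) :
  alldiff_selection F s -> image_set F (prior W i) \subset s @: prior W i.
Proof.
case/andP=> /forallP sF /injectiveP sinj.
have [n] := ubnP (i : nat); elim: n i => // n IHn i ltin.
apply/subsetP => y /image_setP[z /bigcupP[j ltji Wz] Fzy].
have IHj := IHn j (leq_trans ltji ltin).
have sW : s @: tnth W j = image_set (stage F W j) (tnth W j).
  apply/eqP; rewrite eqEcard card_imset //; apply/andP; split; last first.
    (* Block [j] is not the last one, because [j < i < m]. *)
    have := hall_critical hW (leq_ltn_trans ltji (ltn_ord i)).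
    by case/and3P=> _ _ /eqP->.
  apply/subsetP => _ /imsetP[u Wu ->]; apply/image_setP; exists u => //.
  rewrite inE sF andbT; apply/negP => /(subsetP IHj)/imsetP[v Pv /sinj uv].
  case/bigcupP: Pv => k ltkj; rewrite -uv => Wk.
  by rewrite (block_inj Wu Wk) ltnn in ltkj.
have [Py | nPy] := boolP (y \in image_set F (prior W j)).
  have /imsetP[v /bigcupP[k ltkj Wv] ->] := subsetP IHj _ Py.
  exact/imset_f/(block_prior Wv)/(ltn_trans ltkj).
have : y \in s @: tnth W j.
  by rewrite sW; apply/image_setP; exists z => //; rewrite inE nPy.
by case/imsetP=> v Wv ->; apply/imset_f/(block_prior Wv).
Qed.

(** A value from the earlier blocks is already taken by [s] at a point there, which injectivity
    would identify with [x]. *)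
Lemma alldiff_kernel_sub i x :
  x \in tnth W i -> alldiff_kernel F x \subset stage F W i x.
Proof.
move=> Wx; apply/subsetP => y; rewrite inE => /andP[Fxy /existsP[s]].
case/andP=> sA /eqP sx; rewrite inE Fxy andbT; apply/negP.
move/(subsetP (alldiff_image_prior i sA))/imsetP=> [v Pv].
rewrite -sx; case/andP: (sA) => _ /injectiveP sinj /sinj xv.
case/bigcupP: Pv => k ltki; rewrite -xv => Wk.
by rewrite (block_inj Wx Wk) ltnn in ltki.
Qed.

Lemma stage_sub_alldiff_kernel i x :
  x \in tnth W i -> stage F W i x \subset alldiff_kernel F x.
Proof.
move=> Wx; apply/subsetP => y Gy.
(* The value [y] is prescribed on block [i] alone; stating this as an implication lets the matchings
   of all blocks be chosen at once. *)
have /fin_all_exists[f fP] : forall j : 'I_m, exists f : X -> Y,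
    matching (tnth W j) (stage F W j) f /\ (j = i -> f x = y).
  move=> j; have [-> | nji] := eqVneq j i.
    by have [f mf fx] := surplus_matching (@block_surplus i) Wx Gy; exists f.
  (* On the other blocks any matching will do, so an arbitrary value is prescribed at an arbitrary
     point. *)
  have [z Wz] := set0Pn _ (hall_neq0 hW j).
  have [t Gt] := set0Pn _ (hall_value_neq0 hW Wz).
  have [f mf _] := surplus_matching (@block_surplus j) Wz Gt.
  by exists f; split=> // ji; rewrite ji eqxx in nji.
have [b bP] := fin_all_exists block_exists.
pose s := [ffun z => f (b z) z].
have sG z : s z \in stage F W (b z) z.
  by rewrite ffunE; case: (fP (b z)) => -[fG _] _; apply: fG.
have sx : s x = y.
  by rewrite ffunE; case: (fP (b x)) => _; apply; apply: block_inj (bP x) Wx.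
rewrite inE; case/setDP: (Gy) => -> _; apply/existsP; exists s.
rewrite sx eqxx andbT; apply/andP; split.
  by apply/forallP => z; case/setDP: (sG z).
apply/injectiveP => z t ezt.
(* Different blocks have disjoint stage values; within one block, the chosen matching is
   injective. *)
have [ltb | ltb | /val_inj eb] := ltngtP (b z) (b t).
- by have := stage_disjoint t (bP z) ltb (sG z); rewrite ezt sG.
- by have := stage_disjoint z (bP t) ltb (sG t); rewrite -ezt sG.
have [[_ finj] _] := fP (b z); apply: finj; rewrite ?bP //.
  by rewrite eb bP.
by move: ezt; rewrite !ffunE -eb.
Qed.

Lemma alldiff_kernel_block i x :
  x \in tnth W i -> alldiff_kernel F x = stage F W i x.
Proof.
move=> Wx; apply/eqP.
by rewrite eqEsubset alldiff_kernel_sub // stage_sub_alldiff_kernel.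
Qed.

End HallPartition.

Theorem theorem4p1 (X Y : finType) (X_gt0 : 0 < #|X|) (Y_gt0 : 0 < #|Y|)
    (F : X -> {set Y}) (m : nat) (W : m.-tuple {set X})
    (hW : hall_partition F W) :
  (forall x : X, alldiff_kernel F x = partition_map F W x) /\
  (forall (i : 'I_m) (x : X), x \in tnth W i ->
     alldiff_kernel F x =
       F x :\: image_set F (\bigcup_(j < m | j < i) tnth W j)).
Proof.
split=> [x | i x]; last exact: alldiff_kernel_block.
rewrite /partition_map; case: pickP => [i | noblock].
  exact: alldiff_kernel_block.
by have [i] := block_exists hW x; rewrite noblock.
Qed.
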